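(* Given $\varepsilon>0$ and a meaningful sampled data $\{\tilde x_t\}_{1\le t\le N}$ in an orbit $\{x_t\}_{t\ge 1}$ of a nearly eventually periodic (NEP) data-driven system $\Sigma\subseteq\mathbb{C}^n$, if $\mathrm{Ind}_\varepsilon(\{\tilde x_t\})=(s,T)$, then $\{x_t\}_{t\ge1}$ is $2\varepsilon$-almost controlled by $\mathcal{Z}_{s+T}(p)$ for $p(z)=z^{s+T}-z^s$. Furthermore, the sequence $\{z_t\}_{t\ge 1}$ determined by $z_1=x_1$ and $$z_{t+1}=[\,x_1\ \cdots\ x_{s+T}\,]\,C_{s+1,s+T}^{\,t}\,\hat e_{1,s+T},\qquad t\ge 1,$$ satisfies the condition $\mathrm{Ind}_\varepsilon(\{z_t\})=(s,T)$, and for each integer $t\ge 1$ we have $\|z_t-x_t\|\le 2\varepsilon$.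
   Context: Vectors in $\mathbb{C}^n$ are columns, $\|\cdot\|$ is the Euclidean norm, $\hat e_{j,n}$ is the $j$-th canonical basis vector of $\mathbb{C}^n$, and $[x_1\ \cdots\ x_m]$ is the matrix with columns $x_1,\dots,x_m$. Data-driven system: a discrete-time system with state space $\Sigma\subseteq\mathbb{C}^n$ and state-transition map $\mathcal{T}$, written $\mathcal{T}_t(x)=\mathcal{T}(x,t)$; an orbit $\{x_t\}_{t\ge1}$ satisfies $\mathcal{T}_s(x_t)=x_{t+s}$. Nearly eventually periodic (NEP): an orbit $\{x_t\}_{t\ge1}\subseteq\Sigma\subseteq\mathbb{C}^n$ is NEP if for any $\varepsilon>0$ there are integers $T'\ge1$, $\tau'\ge0$ and a sequence $\{\hat x_t\}_{t\ge1}\subset\mathbb{C}^n$ with $\hat x_1\ne0$ and, for all integers $t\ge1$, $\|\hat x_t-x_t\|\le\varepsilon$ and $\hat x_{t+\tau'+T'}=\hat x_{t+\tau'}$. Orbits of a NEP system are NEP orbits. For fixed $\varepsilon>0$, the smallest integers $0\le\tau\le\tau'$ and $1\le T\le T'$ for which these relations hold form the $\varepsilon$-index $\mathrm{ind}_\varepsilon(\{x_t\})=(\tau,T)$. Generic cyclic shift: $C_{k,n}=\hat e_{k,n}\hat e_{n,n}^*+\sum_{j=1}^{n-1}\hat e_{j+1,n}\hat e_{j,n}^*\in\mathbb{C}^{n\times n}$. Sample index: for sampled data $\{\tilde x_t\}_{1\le t\le N}$ from an orbit, one writes $\mathrm{Ind}_\varepsilon(\{\tilde x_t\})=(s,T)$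 if there exist integers $s\ge0$, $T\ge1$ such that $s+T\le N-1$ and $$\big\|[\tilde x_k\ \cdots\ \tilde x_{k+s+T-1}]\,C_{s+1,s+T}\,\hat e_{j,s+T}-\tilde x_{k+j}\big\|\le\varepsilon$$ for each $k=1,\dots,N-(s+T)$ and each $1\le j\le s+T$. For an infinite sequence, the same condition is required for all $k\ge1$. Meaningful: given $\varepsilon>0$, the sample $\{\tilde x_t\}_{1\le t\le N}$ from $\{x_t\}_{t\ge1}$ is meaningful if $\mathrm{Ind}_\varepsilon(\{\tilde x_t\})=\mathrm{ind}_\varepsilon(\{x_t\})$, $s+T\le N-1$ for $(s,T)=\mathrm{Ind}_\varepsilon(\{\tilde x_t\})$, and $\|\tilde x_t-x_t\|\le\varepsilon$ for each $1\le t\le s+T$. Algebraic matrix set: for $p\in\mathbb{C}[z]$, $\mathcal{Z}_m(p)=\{X\in\mathbb{C}^{m\times m}: p(X)=0\}$. Almost controlled: given $\varepsilon>0$, $p\in\mathbb{C}[z]$ and a discrete-time dynamical system $(\Sigma,\mathcal{T})$ with $\Sigma\subset\mathbb{C}^n$, a family of orbits in $\Sigma$ is $\varepsilon$-almost controlled by the algebraic matrix set $\mathcal{Z}_m(p)$, for $1\le m\le n$, if for any orbit $\{x_t\}_{t\ge1}$ in the family there are a sample $\{y_t\}_{1\le t\le L}\subseteq\{x_t\}_{t\ge1}$ (of some size $L$) with $y_1=x_1$, a matrix $A\in\mathcal{Z}_L(p)$ and a vector $y\in\mathbb{C}^L$ such that $\big\|[y_1\ \cdots\ y_L]A^ty-\mathcal{T}_t(x_1)\big\|\le\varepsilon$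 for each integer $t\ge1$. A single orbit is almost controlled if the family consisting of it is.
   Formalization: The side condition m ≤ n in ''almost controlled by Z_m(p), 1 ≤ m ≤ n'' is dropped: s+T can exceed n (a period-2 orbit 1, −1, 1, … in C^1 has s+T = 2), so with that condition the claim would fail; when s+T ≤ n the claim is unchanged. *)

(* Defs.v *)
From HB Require Import structures.
From mathcomp Require Import all_boot all_order all_algebra.
From mathcomp Require Import complex.
From mathcomp Require Import classical_sets reals.

Set Implicit Arguments.
Unset Strict Implicit.
Unset Printing Implicit Defensive.

Import Order.TTheory GRing.Theory Num.Theory.
Local Open Scope ring_scope.
Local Open Scope classical_set_scope.
Local Open Scope complex_scope.

(* Sequences indexed by t >= 1 are functions on nat, and samples indexed by
   1 <= t <= N are such a function together with the size N. Values at indices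
   outside the stated range are never used. *)

(* The norm that the libraries put on matrices is the max norm. *)
Definition enorm (R : realType) (n : nat) (v : 'cV[R[i]]_n) : R :=
  Num.sqrt (\sum_(i < n) ComplexField.Normc.normc (v i 0) ^+ 2).

(* Basis vectors are numbered from 1. *)
Definition basis_vec (R : realType) (j n : nat) : 'cV[R[i]]_n :=
  \col_(i < n) (i.+1 == j)%:R.

Definition adjoint (R : realType) (m n : nat) (A : 'M[R[i]]_(m, n)) :
  'M[R[i]]_(n, m) := map_mx (@conjc R) A^T.

(* [x_k ... x_{k+m-1}] *)
Definition columns (R : realType) (n : nat) (x : nat -> 'cV[R[i]]_n)
  (k m : nat) : 'M[R[i]]_(n, m) := \matrix_(i < n, j < m) x (k + j)%N i 0.

Definition cyclic_shift (R : realType) (k n : nat) : 'M[R[i]]_n :=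
  basis_vec R k n *m adjoint (basis_vec R n n)
  + \sum_(1 <= j < n) basis_vec R j.+1 n *m adjoint (basis_vec R j n).

(* Only the part of the structure that orbits refer to is recorded: no
   semigroup law is imposed on the transition map away from orbits. *)
Record data_driven_system (R : realType) (n : nat) := DataDrivenSystem {
  state_space : set 'cV[R[i]]_n;
  transition : 'cV[R[i]]_n -> nat -> 'cV[R[i]]_n;
  transition_state :
    forall x t, state_space x -> state_space (transition x t) }.

Definition is_orbit (R : realType) (n : nat) (S : data_driven_system R n)
  (x : nat -> 'cV[R[i]]_n) : Prop :=
  (forall t, (1 <= t)%N -> state_space S (x t)) /\
  (forall t r, (1 <= t)%N -> transition S (x t) r = x (t + r)%N).

Definition eventually_periodic_approx (R : realType) (n : nat) (eps : R)
  (x : nat -> 'cV[R[i]]_n) (tau T : nat) : Prop :=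
  exists xh : nat -> 'cV[R[i]]_n,
    xh 1%N != 0 /\
    forall t, (1 <= t)%N ->
      enorm (xh t - x t) <= eps /\ xh (t + tau + T)%N = xh (t + tau)%N.

Definition nep (R : realType) (n : nat) (x : nat -> 'cV[R[i]]_n) : Prop :=
  forall eps : R, 0 < eps ->
    exists tau T : nat, (1 <= T)%N /\ eventually_periodic_approx eps x tau T.

Definition nep_system (R : realType) (n : nat) (S : data_driven_system R n) :
  Prop := forall x, is_orbit S x -> nep x.

(* ind_eps({x_t}) = (tau, T). For fixed eps > 0 the admissible pairs need not
   have a componentwise least element (a longer transient can allow a shorter
   period), so "smallest" means that the pair cannot be decreased: a
   componentwise or lexicographically least pair satisfies this too. *)
Definition orbit_index (R : realType) (n : nat) (eps : R)
  (x : nat -> 'cV[R[i]]_n) (tau T : nat) : Prop :=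
  (1 <= T)%N /\ eventually_periodic_approx eps x tau T /\
  forall tau0 T0 : nat, (tau0 <= tau)%N -> (1 <= T0)%N -> (T0 <= T)%N ->
    eventually_periodic_approx eps x tau0 T0 -> tau0 = tau /\ T0 = T.

Definition index_at (R : realType) (n : nat) (eps : R)
  (x : nat -> 'cV[R[i]]_n) (s T k : nat) : Prop :=
  forall j, (1 <= j <= s + T)%N ->
    enorm (columns x k (s + T) *m cyclic_shift R s.+1 (s + T)
             *m basis_vec R j (s + T) - x (k + j)%N) <= eps.

(* Ind_eps({x_t}_{1 <= t <= N}) = (s, T). This is a relation: several pairs
   (s, T) may satisfy it for the same data. *)
Definition sample_index (R : realType) (n : nat) (eps : R) (N : nat)
  (x : nat -> 'cV[R[i]]_n) (s T : nat) : Prop :=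
  (1 <= T)%N /\ (s + T <= N - 1)%N /\
  forall k, (1 <= k <= N - (s + T))%N -> index_at eps x s T k.

Definition sequence_index (R : realType) (n : nat) (eps : R)
  (x : nat -> 'cV[R[i]]_n) (s T : nat) : Prop :=
  (1 <= T)%N /\ forall k, (1 <= k)%N -> index_at eps x s T k.

(* The sample xt of size N is meaningful for the orbit x, where (s, T) is the
   common value in Ind_eps(xt) = ind_eps(x). *)
Definition meaningful (R : realType) (n : nat) (eps : R) (N : nat)
  (xt x : nat -> 'cV[R[i]]_n) (s T : nat) : Prop :=
  sample_index eps N xt s T /\ orbit_index eps x s T /\
  (s + T <= N - 1)%N /\
  forall t, (1 <= t <= s + T)%N -> enorm (xt t - x t) <= eps.

(* horner_mx is only defined for matrices of size m.+1. *)
Definition algebraic_matrix_set (R : realType) (m : nat) (p : {poly R[i]}) :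
  set 'M[R[i]]_m :=
  [set X : 'M[R[i]]_m | \sum_(i < size p) p`_i *: X ^+ i = 0].

(* The sample has size m, the size of the controlling matrices. The ambient
   dimension n does not bound m: an orbit of period 2 in C^1 leads to m = 2. *)
Definition almost_controlled (R : realType) (n : nat)
  (S : data_driven_system R n) (eps : R) (m : nat) (p : {poly R[i]})
  (F : set (nat -> 'cV[R[i]]_n)) : Prop :=
  (1 <= m)%N /\
  forall x, F x ->
    exists (y : nat -> 'cV[R[i]]_n) (A : 'M[R[i]]_m) (v : 'cV[R[i]]_m),
      (forall l, (1 <= l <= m)%N -> exists t, (1 <= t)%N /\ y l = x t) /\
      y 1%N = x 1%N /\
      algebraic_matrix_set p A /\
      forall t, (1 <= t)%N ->
        enorm (columns y 1 m *m A ^+ t *m v - transition S (x 1%N) t) <= eps.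

(* Main.v *)
Require Import Defs.
From HB Require Import structures.
From mathcomp Require Import all_boot all_order all_algebra.
From mathcomp Require Import complex.
From mathcomp Require Import classical_sets reals.
From mathcomp Require Import zify.

Import Order.TTheory GRing.Theory Num.Theory.
Local Open Scope ring_scope.
Local Open Scope classical_set_scope.

(** Put m = s + T and C = C_{s+1,m}. Powers of C move the first basis vector
    along the sequence 1, 2, ..., m, s+1, ..., m, s+1, ..., so the z_t are exactly
    the x_j with j read off this sequence. An approximating sequence that is
    T-periodic after s takes the same value at t and at the t-th term of the
    sequence, hence two applications of the eps-approximation give the bound
    2 eps. The same description makes z exactly T-periodic after s, so the index
    condition holds with error 0. *)

Section EuclideanNorm.
Context {R : realType}.

(** Identifies [enorm] with the norm of the Hermitian form [dotmx], so that the triangle inequality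
    can be taken from there. The transposes appear because [dotmx] acts on row vectors. *)
Lemma enorm_dotmx (n : nat) (v : 'cV[R[i]]_n) :
  (enorm v)%:C%C = sqrtC (dotmx v^T v^T).
Proof.
have v_ge0 : 0 <= \sum_(i < n) ComplexField.Normc.normc (v i 0) ^+ 2.
  by apply: sumr_ge0 => i _; exact: sqr_ge0.
rewrite -[LHS]sqrCK ?ler0c ?sqrtr_ge0//; congr sqrtC.
rewrite -rmorphXn/= sqr_sqrtr// rmorph_sum/= dotmxE mxE.
by apply: eq_bigr => i _; rewrite !mxE -normCK normc_def rmorphXn/=; case: (v i 0).
Qed.

Lemma enormD (n : nat) (u v : 'cV[R[i]]_n) : enorm (u + v) <= enorm u + enorm v.
Proof.
rewrite -lecR rmorphD/= !enorm_dotmx linearD/=.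
exact: (triangle_lerif (@dotmx _ n) u^T v^T).
Qed.

Lemma enormN (n : nat) (v : 'cV[R[i]]_n) : enorm (- v) = enorm v.
Proof.
rewrite /enorm; congr Num.sqrt; apply: eq_bigr => i _.
by rewrite mxE normcN.
Qed.

Lemma enorm0 (n : nat) : enorm (0 : 'cV[R[i]]_n) = 0.
Proof.
rewrite /enorm big1 ?sqrtr0// => i _.
by rewrite mxE ComplexField.Normc.normc0 expr0n.
Qed.

End EuclideanNorm.

Section CyclicShift.
Context {R : realType}.

Lemma mulmx_basis_vec (m n : nat) (A : 'M[R[i]]_(m, n)) (i : 'I_n) :
  A *m basis_vec R i.+1 n = col i A.
Proof.
rewrite colE; congr (_ *m _); apply/matrixP => j k.
by rewrite !mxE eqSS ord1 eqxx andbT.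
Qed.

Lemma columns_basis_vec (n : nat) (x : nat -> 'cV[R[i]]_n) (k m j : nat) :
  (j < m)%N -> columns x k m *m basis_vec R j.+1 m = x (k + j)%N.
Proof.
move=> jm; rewrite (mulmx_basis_vec _ _ _ (Ordinal jm)).
by apply/colP => i; rewrite !mxE.
Qed.

Lemma adjoint_basis_vec (m a j : nat) :
  (0 < j <= m)%N ->
  adjoint (basis_vec R a m) *m basis_vec R j m = ((a == j)%:R)%:M.
Proof.
case: j => // j jm; rewrite (mulmx_basis_vec _ _ _ (Ordinal jm)).
by apply/matrixP => p q; rewrite !ord1 !mxE rmorph_nat eq_sym mulr1n.
Qed.

Definition cyclic_succ (s m j : nat) : nat := if (j < m)%N then j.+1 else s.+1.

(** By orthonormality each rank-one term keeps a single basis vector and kills the others: for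
    [j < m] only the [j]-th summand survives, for [j = m] only the wrap-around term. *)
Lemma cyclic_shift_basis_vec (s m j : nat) :
  (0 < j <= m)%N ->
  cyclic_shift R s.+1 m *m basis_vec R j m = basis_vec R (cyclic_succ s m j) m.
Proof.
move=> jm; have /andP[j0 lejm] := jm.
rewrite /cyclic_shift mulmxDl mulmx_suml -mulmxA adjoint_basis_vec//.
under eq_bigr => i _ do rewrite -mulmxA adjoint_basis_vec// mul_mx_scalar.
rewrite mul_mx_scalar /cyclic_succ.
have [ltjm|gejm] := ltnP j m.
  rewrite gtn_eqF// scale0r add0r (bigD1_seq j) ?iota_uniq ?mem_index_iota ?j0//=.
  rewrite eqxx scale1r big1 ?addr0// => i /negPf->.
  by rewrite scale0r.
have -> : j = m by apply/eqP; rewrite eqn_leq lejm gejm.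
rewrite eqxx scale1r big_nat_cond big1 ?addr0// => i /andP[/andP[_ im] _].
by rewrite ltn_eqF// scale0r.
Qed.

Definition cyclic_index (s m t : nat) : nat := iter t (cyclic_succ s m) 1%N.

Lemma cyclic_index_bounds (s m t : nat) :
  (s < m)%N -> (0 < cyclic_index s m t <= m)%N.
Proof.
move=> sm; elim: t => [|t IH]; first by rewrite (leq_ltn_trans _ sm).
by rewrite /cyclic_index iterS /cyclic_succ; case: ifP.
Qed.

Lemma cyclic_index_small (s m t : nat) :
  (t < m)%N -> cyclic_index s m t = t.+1.
Proof.
elim: t => // t IH tm.
by rewrite /cyclic_index iterS -/(cyclic_index s m t) IH ?(ltnW tm)// /cyclic_succ tm.
Qed.

(** After [m] steps and after [s] steps the index is [s.+1] in both cases; the remaining [t] steps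
    then agree. *)
Lemma cyclic_index_periodic (s m t : nat) :
  (s < m)%N -> cyclic_index s m (t + m) = cyclic_index s m (t + s).
Proof.
move=> sm; rewrite /cyclic_index !iterD; congr iter.
rewrite -!/(cyclic_index s m _) [RHS]cyclic_index_small//.
case: m sm => // m sm.
by rewrite /cyclic_index iterS -/(cyclic_index s m.+1 m) cyclic_index_small// /cyclic_succ ltnn.
Qed.

(* The shift r is what makes the induction on t go through. *)
Lemma eventually_periodic_cyclic_index (X : Type) (y : nat -> X) (s T t r : nat) :
  (0 < T)%N -> (forall j, (0 < j)%N -> y (j + s + T)%N = y (j + s)%N) ->
  y (cyclic_index s (s + T) t + r)%N = y (t.+1 + r)%N.
Proof.
move=> T0 yper; elim: t r => [//|t IH] r.
rewrite addSnnS -IH /cyclic_index iterS -/(cyclic_index s (s + T) t).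
have sm : (s < s + T)%N by rewrite -[X in (X < _)%N]addn0 ltn_add2l.
have /andP[_] := cyclic_index_bounds _ _ t sm.
rewrite /cyclic_succ; case: ltnP => [_ _|ge le]; first by rewrite addSnnS.
(* Wrap-around case, the only one that uses periodicity: the index falls from [s + T] to [s.+1], and
   [yper] at [j = r.+1] absorbs the jump. *)
have -> : cyclic_index s (s + T) t = (s + T)%N by apply/eqP; rewrite eqn_leq le.
by rewrite addSnnS addnC -yper//; congr y; lia.
Qed.

Lemma cyclic_shift_exp_basis_vec (s m t : nat) :
  (s < m)%N ->
  cyclic_shift R s.+1 m ^+ t *m basis_vec R 1 m = basis_vec R (cyclic_index s m t) m.
Proof.
move=> sm; elim: t => [|t IH]; first by rewrite expr0 mul1mx.
by rewrite exprS -mulmxA IH cyclic_shift_basis_vec// cyclic_index_bounds.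
Qed.

Lemma columns_cyclic_shift_exp (n : nat) (x : nat -> 'cV[R[i]]_n) (s m t : nat) :
  (s < m)%N ->
  columns x 1 m *m cyclic_shift R s.+1 m ^+ t *m basis_vec R 1 m =
  x (cyclic_index s m t).
Proof.
move=> sm; rewrite -mulmxA cyclic_shift_exp_basis_vec//.
have := cyclic_index_bounds _ _ t sm.
by case: (cyclic_index s m t) => // j jm; rewrite columns_basis_vec.
Qed.

(** The first basis vector is cyclic: column [i] of a power of the shift is that power applied to
    the [i]-th iterate of this vector, so periodicity of [cyclic_index] settles every column at
    once. *)
Lemma cyclic_shift_expn (s m : nat) :
  (s < m)%N -> cyclic_shift R s.+1 m ^+ m = cyclic_shift R s.+1 m ^+ s.
Proof.
move=> sm; apply/matrixP => j i;
suff /colP/(_ j) : col i (cyclic_shift R s.+1 m ^+ m) =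
                   col i (cyclic_shift R s.+1 m ^+ s) by rewrite !mxE.
rewrite -!mulmx_basis_vec -(cyclic_index_small s m i)// -cyclic_shift_exp_basis_vec// !mulmxA.
rewrite -![_ *m cyclic_shift _ _ _ ^+ _]exprD !cyclic_shift_exp_basis_vec//.
by rewrite addnC cyclic_index_periodic// addnC.
Qed.

Lemma algebraic_matrix_set_cyclic_shift (s m : nat) :
  (s < m)%N -> algebraic_matrix_set ('X^m - 'X^s) (cyclic_shift R s.+1 m).
Proof.
move=> sm; rewrite /algebraic_matrix_set/=.
(* Since [s < m] the polynomial has size [m.+1], and only the coefficients at [m] and [s]
   contribute. *)
rewrite size_polyDl ?size_polyN !size_polyXn ?ltnS//.
under eq_bigr => i _ do rewrite coefB !coefXn scalerBl !scaler_nat !mulrb.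
rewrite sumrB -!big_mkcond/=.
rewrite (big_pred1 (Ordinal (ltnSn m)))//=.
rewrite (big_pred1 (Ordinal (leqW sm)))//=.
by rewrite cyclic_shift_expn// subrr.
Qed.

Lemma sequence_index_eventually_periodic (n : nat) (eps : R)
    (z : nat -> 'cV[R[i]]_n) (s T : nat) :
  0 <= eps -> (0 < T)%N ->
  (forall k, (0 < k)%N -> z (k + s + T)%N = z (k + s)%N) ->
  sequence_index eps z s T.
Proof.
move=> eps0 T0 zper; split=> // k k0 j jm.
rewrite -mulmxA cyclic_shift_basis_vec// /cyclic_succ.
have /andP[_ lejm] := jm.
(* For [j < s + T] the shifted column is exactly the next term; the last column compares [z (k + s)]
   with [z (k + s + T)]. *)
case: ltnP => [ltjm|gejm]; rewrite columns_basis_vec; do ?lia.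
  by rewrite subrr enorm0.
have -> : j = (s + T)%N by lia.
by rewrite addnA zper// subrr enorm0.
Qed.

Lemma eventually_periodic_approx_cyclic_index (n : nat) (eps : R)
    (x : nat -> 'cV[R[i]]_n) (s T t : nat) :
  (0 < T)%N -> eventually_periodic_approx eps x s T ->
  enorm (x (cyclic_index s (s + T) t) - x t.+1) <= 2 * eps.
Proof.
move=> T0 [y [_ xy]].
have := eventually_periodic_cyclic_index _ y s T t 0 T0 (fun j j0 => (xy j j0).2).
rewrite !addn0; set c := cyclic_index _ _ _ => yc.
have /andP[c0 _] : (0 < c <= s + T)%N by apply: cyclic_index_bounds; lia.
have -> : x c - x t.+1 = - (y c - x c) + (y t.+1 - x t.+1).
  by rewrite yc opprB addrA subrK.
rewrite mulr_natl mulr2n (le_trans (enormD _ _ _))// enormN lerD//.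
  exact: (xy _ c0).1.
exact: (xy t.+1 isT).1.
Qed.

End CyclicShift.

Theorem theorem3p6 (R : realType) (n : nat) (S : data_driven_system R n)
    (eps : R) (N : nat) (xt x : nat -> 'cV[R[i]]_n) (s T : nat) :
  0 < eps ->
  nep_system S ->
  is_orbit S x ->
  meaningful eps N xt x s T ->
  almost_controlled S (2 * eps) (s + T) ('X^(s + T) - 'X^s) [set x] /\
  forall z : nat -> 'cV[R[i]]_n,
    z 1%N = x 1%N ->
    (forall t, (1 <= t)%N ->
       z t.+1 = columns x 1 (s + T) *m cyclic_shift R s.+1 (s + T) ^+ t
                  *m basis_vec R 1 (s + T)) ->
    sequence_index eps z s T /\
    forall t, (1 <= t)%N -> enorm (z t - x t) <= 2 * eps.
Proof.
move=> eps0 _ [_ xorb] [_ [[T0 [xper _]] _]].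
have sm : (s < s + T)%N by lia.
split.
  split; first by lia.
  (* The sample is the initial segment of the orbit itself, so the controlled sequence takes the
     values [x (cyclic_index s (s + T) t)]. *)
  move=> _ ->; exists x, (cyclic_shift R s.+1 (s + T)), (basis_vec R 1 (s + T)).
  split; first by move=> l /andP[l1 _]; exists l.
  split=> //; split; first exact: algebraic_matrix_set_cyclic_shift.
  move=> t _; rewrite columns_cyclic_shift_exp// xorb// add1n.
  exact: eventually_periodic_approx_cyclic_index.
move=> z z1 zS.
(* The initial condition is the case [t = 0] of this formula, as [cyclic_index] starts at 1. *)
have zE t : z t.+1 = x (cyclic_index s (s + T) t).
  by case: t => [|t]; rewrite ?z1// zS// columns_cyclic_shift_exp.
split=> [|[|t] // _].
  apply: sequence_index_eventually_periodic => //; first exact: ltW.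
  by case=> // k _; rewrite -addnA !addSn !zE cyclic_index_periodic.
rewrite zE; exact: eventually_periodic_approx_cyclic_index.
Qed.
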